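(* The $\Lambda$-duplicate $D=\Lambda\times\{1,-1\}$, with the topology having basis $\{W(r,t,i) : t\in\Lambda,\ i\in\{1,-1\},\ r\in\Lambda\cup\{0\},\ r\prec t\}$, has a $G_\delta$-diagonal but is not Gruenhage.
   Context: All topological spaces are Hausdorff. The tree $\Lambda$: $\Lambda$ is the set of all injective functions $t:\alpha\to\omega$, where $\alpha$ is a countable ordinal and $\omega\setminus\operatorname{ran} t$ is infinite; $s\preccurlyeq t$ means that $t$ extends $s$. Write $\operatorname{dom} t$ for the domain of $t$ and $\operatorname{ran} t$ for its range. Let $0$ be an extra element not in $\Lambda$ (distinct from the empty function $\varnothing\in\Lambda$), with $0\prec t$ for all $t\in\Lambda$. For $t\in\Lambda$ and $r\in\Lambda\cup\{0\}$ let $(r,t]=\{s\in\Lambda : r\prec s\preccurlyeq t\}$. The sequences $\tau(s,t)$: for $s,t\in\Lambda$ with $s\prec t$, define ordinals $\operatorname{dom} t=\beta_0>\beta_1>\dots>\beta_k=\operatorname{dom} s$ as follows: given $\beta_i>\operatorname{dom} s$, let $\beta_{i+1}\in[\operatorname{dom} s,\beta_i)$ be the unique ordinal such that $t(\beta_{i+1})\le t(\xi)$ for all $\xi\in[\operatorname{dom} s,\beta_i)$; the process stops at a finite stage $k>0$ with $\beta_k=\operatorname{dom} s$. Put $\tau(s,t)=(\beta_k,\dots,\beta_1)$, and let $\tau(t,t)$ be the empty sequence. Let $\ell(s,t)$ be the length of $\tau(s,t)$. The $\Lambda$-duplicate: $D=\Lambda\times\{1,-1\}$. For $(t,i)\in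 D$ and $r\in\Lambda\cup\{0\}$ with $r\prec t$, let $$W(r,t,i)=\{(s,j)\in D : s\in(r,t]\text{ and } j=(-1)^{\ell(s,t)}i\}.$$ The sets $W(r,t,i)$ form a basis for a topology on $D$; $D$ with this topology is called the $\Lambda$-duplicate. A space $X$ has a $G_\delta$-diagonal if its diagonal is a $G_\delta$ set in $X^2$; equivalently, there is a sequence $(\mathscr{G}_n)_{n=1}^\infty$ of open covers of $X$ such that for any distinct $x,y\in X$ there is $n$ such that $\{x,y\}\cap U$ is at most a singleton for all $U\in\mathscr{G}_n$. A space $X$ is Gruenhage if there exist a sequence $(\mathscr{U}_n)_{n=1}^\infty$ of families of open subsets of $X$ and sets $R_n$, $n\ge1$, such that (1) for any distinct $x,y\in X$ there exist $n$ and $U\in\mathscr{U}_n$ such that $\{x,y\}\cap U$ is a singleton, and (2) $U\cap V=R_n$ whenever $U,V\in\mathscr{U}_n$ are distinct. *)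

(* Defs.v *)
From HB Require Import structures.
From mathcomp Require Import all_boot all_order all_algebra.
From mathcomp Require Import boolp classical_sets functions cardinality.
From mathcomp Require Import wochoice topology borel_hierarchy.

Set Implicit Arguments.
Unset Strict Implicit.
Unset Printing Implicit Defensive.

Import Order.TTheory GRing.Theory.

Local Open Scope classical_set_scope.

(* A well-ordering of the uncountable type [set nat] is fixed, and [omega1] is
   the set of its elements with countably many predecessors.  It is a
   well-order of type omega_1: it is well-founded ([omega1_min]), its proper
   initial segments are countable ([omega1_initial_countable]), and it is
   uncountable ([omega1_uncountable]).  As usual, the element [a : omega1]
   stands for the countable ordinal [{x | x < a}]. *)

Definition wo_le : rel (set nat) := sval (well_ordering_principle (set nat)).

Lemma wo_leP : well_order wo_le.
Proof. exact: svalP (well_ordering_principle (set nat)). Qed.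

Lemma wo_leW : wo_chain wo_le predT.
Proof. by move=> A _; apply: wo_leP. Qed.

Lemma wo_le_refl : reflexive wo_le.
Proof. by move=> x; apply: (wo_chain_reflexive wo_leW). Qed.

Lemma wo_le_anti : antisymmetric wo_le.
Proof. by move=> x y; apply: (wo_chain_antisymmetric wo_leW). Qed.

Lemma wo_le_total : total wo_le.
Proof. by move=> x y; apply: (wo_chainW wo_leW). Qed.

Lemma wo_le_trans : transitive wo_le.
Proof.
move=> y x z xy yz.
have [|m [[mA mP] _]] := wo_leP (A := [pred u | u \in [:: x; y; z]]).
  by exists x; rewrite !inE eqxx.
have mx : wo_le m x by apply: mP; rewrite !inE eqxx.
have my : wo_le m y by apply: mP; rewrite !inE eqxx orbT.
have mz : wo_le m z by apply: mP; rewrite !inE eqxx !orbT.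
move: mA; rewrite !inE => /or3P[] /eqP E; subst m => //.
- by have -> : x = y by apply: wo_le_anti; rewrite xy mx.
- by have <- : y = z by apply: wo_le_anti; rewrite yz my.
Qed.

Definition omega1 :=
  {x : set nat | `[< countable [set y | wo_le y x && (y != x)] >]}.

HB.instance Definition _ := Choice.on omega1.

Fact omega1_display : Order.disp_t. Proof. exact: Order.Disp tt tt. Qed.

Definition omega1_le : rel omega1 := fun x y => wo_le (val x) (val y).

Lemma omega1_le_refl : reflexive omega1_le.
Proof. by move=> x; apply: wo_le_refl. Qed.

Lemma omega1_le_anti : antisymmetric omega1_le.
Proof. by move=> x y /wo_le_anti/val_inj. Qed.

Lemma omega1_le_trans : transitive omega1_le.
Proof. by move=> y x z; apply: wo_le_trans. Qed.

HB.instance Definition _ := Order.Le_isPOrder.Build omega1_display omega1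
  omega1_le_refl omega1_le_anti omega1_le_trans.

Lemma omega1_le_total : total (<=%O : rel omega1).
Proof. by move=> x y; apply: wo_le_total. Qed.

HB.instance Definition _ :=
  Order.POrder_isTotal.Build omega1_display omega1 omega1_le_total.

Lemma omega1_min (A : set omega1) : A !=set0 ->
  exists2 m, A m & forall x, A x -> (m <= x)%O.
Proof.
move=> [a Aa].
have [|m [[mA mP] _]] := wo_leP (A := [pred u | `[< exists2 x, A x & val x = u >]]).
  by exists (val a); apply/asboolP; exists a.
move/asboolP: mA => [x Ax xm]; exists x => // y Ay.
by rewrite /Order.le /= /omega1_le xm; apply: mP; apply/asboolP; exists y.
Qed.

Lemma omega1_ind (P : omega1 -> Prop) :
  (forall x, (forall y, (y < x)%O -> P y) -> P x) -> forall x, P x.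
Proof.
move=> IH x; apply: contrapT => nPx.
have [|m nPm mmin] := @omega1_min [set y | ~ P y]; first by exists x.
apply: nPm; apply: IH => y ym; apply: contrapT => /mmin.
by rewrite leNgt ym.
Qed.

Lemma omega1_initial_countable (a : omega1) : countable [set x | (x < a)%O].
Proof.
have /asboolP/countable_injP[f finj] := valP a.
apply/countable_injP; exists (f \o val) => x y; rewrite !inE /= => xa ya.
move/finj; rewrite !inE => E; apply/val_inj/E.
- by rewrite /= (ltW xa : wo_le _ _); move: xa; rewrite lt_def => /andP[/eqP xa _];
    apply/eqP => /val_inj /esym /xa.
- by rewrite /= (ltW ya : wo_le _ _); move: ya; rewrite lt_def => /andP[/eqP ya _];
    apply/eqP => /val_inj /esym /ya.
Qed.

Lemma omega1_uncountable : ~ countable [set: omega1].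
Proof.
move=> /countable_injP[f finj].
have all_omega1 (x : set nat) : `[< countable [set y | wo_le y x && (y != x)] >].
  apply: contrapT => nx.
  pose B := [pred u | ~~ `[< countable [set y | wo_le y u && (y != u)] >]].
  have [|m [[mB mP] _]] := wo_leP (A := B); first by exists x; apply/negP.
  move/negP: mB; apply; apply/asboolP/countable_injP.
  exists (fun u => oapp f 0%N (insub u)) => u v; rewrite !inE.
  have key w : wo_le w m && (w != m) -> exists2 z : omega1, val z = w & insub w = Some z.
    move=> /andP[wm wnm].
    have Pw : `[< countable [set y | wo_le y w && (y != w)] >].
      apply: contraNT wnm => /mP mw; apply/eqP/wo_le_anti; by rewrite wm mw.
    by exists (Sub w Pw); rewrite ?SubK ?insubT.
  move=> /key[z <- ->] /key[z' <- ->] /= /finj -> //; by rewrite inE.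
have ginj : injective (fun x => f (Sub x (all_omega1 x))).
  by move=> x y /finj E; have := congr1 val (E _ _); rewrite !SubK; apply; rewrite inE.
set g := (fun x => _) in ginj.
pose A := [set n | exists2 B, g B = n & ~ B n].
have nA : ~ A (g A).
  by move=> /[dup] AA [B /ginj BA nB]; apply: nB; rewrite {1}BA.
by case: (nA); exists A.
Qed.

(* An injective function from the ordinal [dom t] to the natural numbers is
   encoded as a map [omega1 -> option nat] that is defined exactly on the
   ordinals below [dom t]. *)

Record Lambda := MkLambda {
  dom : omega1;
  fn : omega1 -> option nat;
  fn_dom : forall x, (fn x != None) = (x < dom)%O;
  fn_inj : forall x y n, fn x = Some n -> fn y = Some n -> x = y;
  fn_coinf : infinite_set (~` [set n | exists x, fn x = Some n]) }.

HB.instance Definition _ := gen_eqMixin Lambda.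
HB.instance Definition _ := gen_choiceMixin Lambda.

Definition prec_eq (s t : Lambda) : Prop :=
  forall x n, fn s x = Some n -> fn t x = Some n.

(* the extra element 0 is [None] *)
Definition prec (r : option Lambda) (t : Lambda) : Prop :=
  if r is Some s then prec_eq s t /\ s <> t else True.

Definition interval (r : option Lambda) (t : Lambda) : set Lambda :=
  [set s | prec r s /\ prec_eq s t].

(* the value of [t] at [x], meaningful for [x < dom t] only *)
Definition ev (t : Lambda) (x : omega1) : nat := odflt 0%N (fn t x).

Definition is_argmin (t : Lambda) (a b c : omega1) : Prop :=
  (a <= c < b)%O /\ forall x, (a <= x < b)%O -> (ev t c <= ev t x)%N.

(* If [b] is the term [beta_i] of the sequence starting at [dom t], then
   [descent s t b l] says that [l] is [(beta_k, ..., beta_(i+1))]. *)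
Inductive descent (s t : Lambda) : omega1 -> seq omega1 -> Prop :=
| DescentStop : descent s t (dom s) [::]
| DescentStep b c l : (dom s < b)%O -> is_argmin t (dom s) b c ->
    descent s t c l -> descent s t b (rcons l c).

(* see [descent_tau] and [descent_uniq] for existence and uniqueness *)
Definition tau (s t : Lambda) : seq omega1 :=
  xget [::] [set l | descent s t (dom t) l].

Definition ell (s t : Lambda) : nat := size (tau s t).

Lemma fn_ev t x : (x < dom t)%O -> fn t x = Some (ev t x).
Proof. by rewrite -fn_dom /ev; case: (fn t x). Qed.

Lemma fn_None t x : (dom t <= x)%O -> fn t x = None.
Proof. by rewrite leNgt -fn_dom negbK => /eqP. Qed.

Lemma ev_inj t x y : (x < dom t)%O -> (y < dom t)%O -> ev t x = ev t y -> x = y.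
Proof.
move=> /fn_ev xE /fn_ev yE E; apply: (fn_inj xE).
by rewrite E.
Qed.

Lemma Lambda_eqP s t : fn s = fn t -> s = t.
Proof.
move=> E; have ED : dom s = dom t.
  have lt_dom x : (x < dom s)%O = (x < dom t)%O by rewrite -!fn_dom E.
  apply/eqP; rewrite eq_le !leNgt.
  by rewrite -lt_dom ltxx lt_dom ltxx.
case: s t E ED => [d f p1 p2 p3] [d' f' q1 q2 q3] /= E ED.
by subst d' f'; congr MkLambda; apply: Prop_irrelevance.
Qed.

Lemma prec_eq_refl t : prec_eq t t. Proof. by []. Qed.

Lemma prec_eq_trans s t u : prec_eq s t -> prec_eq t u -> prec_eq s u.
Proof. by move=> st tu x n /st/tu. Qed.

Lemma prec_eq_dom s t : prec_eq s t -> (dom s <= dom t)%O.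
Proof.
move=> st; rewrite leNgt; apply/negP => ts.
have := st _ _ (fn_ev ts) => E.
by have := fn_dom t (dom t); rewrite ltxx E.
Qed.

Lemma prec_eq_ev s t x : prec_eq s t -> (x < dom s)%O -> ev t x = ev s x.
Proof. by move=> st /fn_ev/st E; rewrite {1}/ev E. Qed.

Lemma prec_eq_under u v t : prec_eq u t -> prec_eq v t ->
  (dom u <= dom v)%O -> prec_eq u v.
Proof.
move=> ut vt uv x n xn.
have xu : (x < dom u)%O by rewrite -fn_dom xn.
have /fn_ev xE : (x < dom v)%O by apply: lt_le_trans uv.
by rewrite xE; have := vt _ _ xE; rewrite (ut _ _ xn) => -[->].
Qed.

Lemma prec_eq_anti s t : prec_eq s t -> prec_eq t s -> s = t.
Proof.
move=> st ts; apply/Lambda_eqP/funext => x.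
case E : (fn s x) => [n|]; first by rewrite (st _ _ E).
by case E' : (fn t x) => [n|//]; rewrite (ts _ _ E') in E.
Qed.

Lemma prec_eq_eq s t : prec_eq s t -> dom s = dom t -> s = t.
Proof.
by move=> st E; apply: prec_eq_anti => //; apply: (prec_eq_under _ st); rewrite ?E.
Qed.

Lemma prec_dom s t : prec (Some s) t -> (dom s < dom t)%O.
Proof.
move=> [st nst]; rewrite lt_neqAle prec_eq_dom // andbT.
by apply/eqP => /(prec_eq_eq st).
Qed.

Lemma prec_prec_eq r s t : prec r s -> prec_eq s t -> prec r t.
Proof.
case: r => [r|//] /[dup] rs [rs1 _] st; split; first exact: prec_eq_trans st.
by move=> E; have := prec_dom rs; rewrite ltNge {1}E prec_eq_dom.
Qed.

Lemma prec_eq_prec r s t : prec_eq r s -> prec (Some s) t -> prec (Some r) t.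
Proof.
move=> rs /[dup] st [st1 _]; split; first exact: prec_eq_trans st1.
by move=> E; have := prec_dom st; rewrite -E ltNge prec_eq_dom.
Qed.

Lemma argmin_exists t a b : (a < b)%O -> exists c, is_argmin t a b c.
Proof.
move=> ab; pose P n := `[< exists2 x, (a <= x < b)%O & ev t x = n >].
have exP : exists n, P n by exists (ev t a); apply/asboolP; exists a; rewrite ?lexx.
case: (ex_minnP exP) => n /asboolP[c cab cn] nmin; exists c; split=> // x xab.
by rewrite cn; apply: nmin; apply/asboolP; exists x.
Qed.

Lemma argmin_uniq t a b c d : (b <= dom t)%O ->
  is_argmin t a b c -> is_argmin t a b d -> c = d.
Proof.
move=> bt [cab cmin] [dab dmin]; apply: (@ev_inj t).
- by case/andP: cab => _ cb; apply: lt_le_trans bt.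
- by case/andP: dab => _ db; apply: lt_le_trans bt.
- by apply/eqP; rewrite eqn_leq cmin // dmin.
Qed.

Lemma descent_exists s t b : (dom s <= b)%O -> exists l, descent s t b l.
Proof.
elim/omega1_ind: b => b IH; rewrite le_eqVlt => /orP[/eqP <-|sb].
  by exists [::]; apply: DescentStop.
have [c cP] := argmin_exists t sb.
have /andP[sc cb] := cP.1.
by have [l lP] := IH c cb sc; exists (rcons l c); apply: DescentStep cP lP.
Qed.

Lemma descent_uniq s t b l l' : (b <= dom t)%O ->
  descent s t b l -> descent s t b l' -> l = l'.
Proof.
move=> bt sl; elim: sl bt l' => [|{}b c {}l sb cP _ IH] bt l' sl'.
  inversion sl' as [|b' c' l1 sb' cP' cl']; subst => //.
  by rewrite ltxx in sb'.
inversion sl' as [E|b' c' l1 sb' cP' cl']; subst.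
  by rewrite ltxx in sb.
have E := argmin_uniq bt cP cP'; subst c'.
have /andP[_ /ltW cb] := cP.1.
by congr rcons; apply: IH => //; apply: le_trans bt.
Qed.

Lemma descent_tau s t : prec_eq s t -> descent s t (dom t) (tau s t).
Proof.
move=> /prec_eq_dom /(descent_exists t)[l lP].
exact: (@xgetPex _ [::] [set l | descent s t (dom t) l] (ex_intro _ l lP)).
Qed.

Lemma tau_uniq s t l : descent s t (dom t) l -> tau s t = l.
Proof.
move=> sl; have sP := @xgetPex _ [::] [set l | descent s t (dom t) l] (ex_intro _ l sl).
exact: (descent_uniq (lexx _) sP sl).
Qed.

Lemma tau_refl t : tau t t = [::].
Proof. exact/tau_uniq/DescentStop. Qed.

Lemma ell_refl t : ell t t = 0%N. Proof. by rewrite /ell tau_refl. Qed.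

Lemma omega1_inhabited : exists x : omega1, True.
Proof.
apply: contrapT => nx; apply: omega1_uncountable.
by apply/countable_injP; exists (fun=> 0%N) => x; case: nx; exists x.
Qed.

HB.instance Definition _ := isPointed.Build omega1 (sval (cid omega1_inhabited)).

Lemma omega1_bottom : {z : omega1 | forall x, (z <= x)%O}.
Proof.
by apply: cid; have [|m _ mP] := @omega1_min setT; [exists point | exists m => x; apply: mP].
Qed.

Definition empty_fun : Lambda.
Proof.
refine (@MkLambda (sval omega1_bottom) (fun=> None) _ _ _) => //.
- by move=> x /=; apply/esym/negbTE; rewrite -leNgt; apply: (svalP omega1_bottom).
- rewrite (_ : ~` _ = setT); first exact: infinite_nat.
  by apply/seteqP; split=> // n _ [x].
Defined.

HB.instance Definition _ := isPointed.Build Lambda empty_fun.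

Definition restr (s : Lambda) (d : omega1) : Lambda.
Proof.
refine (@MkLambda (Order.min d (dom s)) (fun x => if (x < d)%O then fn s x else None) _ _ _).
- by move=> x; rewrite lt_min; case: ifP => //= _; rewrite fn_dom.
- by move=> x y n; case: ifP => // _; case: ifP => // _; apply: fn_inj.
- apply: sub_infinite_set (@fn_coinf s) => n /= nn [x]; case: ifP => // _ E.
  by apply: nn; exists x.
Defined.

Lemma restr_prec_eq s d : prec_eq (restr s d) s.
Proof. by move=> x n /=; case: ifP. Qed.

Lemma restr_dom s d : (d <= dom s)%O -> dom (restr s d) = d.
Proof. by move=> /= /min_idPl. Qed.

Lemma restr_prec s d : (d < dom s)%O -> prec (Some (restr s d)) s.
Proof.
move=> ds; split; first exact: restr_prec_eq.
by move=> E; have := restr_dom (ltW ds); rewrite E => E'; rewrite E' ltxx in ds.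
Qed.

Lemma prec_max r1 r2 s : prec r1 s -> prec r2 s ->
  exists2 r, prec r s & forall u, prec_eq u s -> prec r u -> prec r1 u /\ prec r2 u.
Proof.
case: r1 r2 => [r1|] [r2|] p1 p2; [|by exists (Some r1)|by exists (Some r2)|by exists None].
case/orP: (le_total (dom r1) (dom r2)) => r12.
  have r12' := prec_eq_under p1.1 p2.1 r12.
  by exists (Some r2) => // u us ru; split=> //; apply: prec_eq_prec ru.
have r12' := prec_eq_under p2.1 p1.1 r12.
by exists (Some r1) => // u us ru; split=> //; apply: prec_eq_prec ru.
Qed.

Lemma prec_large_values s (M : nat) : exists2 r, prec r s &
  forall u, prec_eq u s -> prec r u ->
  forall x, (dom u <= x < dom s)%O -> (M <= ev s x)%N.
Proof.
elim: M => [|M [r rs rP]]; first by exists None.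
have [[x xs xM]|nx] := pselect (exists2 x, (x < dom s)%O & ev s x = M); last first.
  exists r => // u us ru x /[dup] uxs /andP[ux xs]; rewrite ltn_neqAle (rP u) // andbT.
  by apply/eqP => E; apply: nx; exists x.
have [r' rs' r'P] := prec_max rs (restr_prec xs).
exists r' => // u us /(r'P u us)[ru1 ru2] y /[dup] uys /andP[uy ys].
rewrite ltn_neqAle (rP u) // andbT; apply/eqP => E.
have yx : y = x by apply: (@ev_inj s) => //; rewrite -E.
by have := prec_dom ru2; rewrite restr_dom ?(ltW xs) // ltNge -yx uy.
Qed.

Lemma descent_prec_eq u s t b l : prec_eq s t -> (b <= dom s)%O ->
  descent u s b l -> descent u t b l.
Proof.
move=> st bs sl; elim: sl bs => [|{}b c {}l ub [cab cmin] _ IH] bs.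
  exact: DescentStop.
have /andP[_ cb] := cab.
apply: (DescentStep ub); last by apply: IH; apply/ltW/lt_le_trans/bs.
split=> // x xab; have /andP[_ xb] := xab.
rewrite !(prec_eq_ev st) ?cmin //; exact: lt_le_trans bs.
Qed.

Lemma descent_cat u s t b l l' : prec_eq u s -> prec_eq s t -> (b <= dom t)%O ->
  (forall x, (dom u <= x < dom s)%O -> (ev t (dom s) <= ev t x)%N) ->
  descent s t b l -> descent u s (dom s) l' -> descent u t b (l' ++ l).
Proof.
move=> us st bt big sl sl'; elim: sl bt => [|{}b c {}l sb [cab cmin] _ IH] bt.
  by rewrite cats0; apply: descent_prec_eq sl'.
have us' := prec_eq_dom us.
have /andP[sc cb] := cab.
rewrite -rcons_cat; apply: DescentStep; first exact: le_lt_trans sb.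
  split; first by rewrite (le_trans us' sc).
  move=> x /andP[ux xb]; have [sx|xs] := leP (dom s) x; first by rewrite cmin ?sx.
  by apply: leq_trans (big x _); rewrite ?cmin ?lexx ?ux.
by apply: IH; apply: le_trans bt; apply: ltW.
Qed.

(* The values of [t] on [[dom u, dom s)] exceed [t (dom s)] for [u] close enough
   to [s]; this is what makes the sets [W] a basis. *)
Lemma ell_add s t : prec_eq s t -> exists2 r, prec r s &
  forall u, interval r s u -> ell u t = (ell u s + ell s t)%N.
Proof.
move=> st; have [->|nst] := eqVneq s t.
  by exists None => // u _; rewrite ell_refl addn0.
have sdt : (dom s < dom t)%O by apply: prec_dom; split=> //; apply/eqP.
have [r rs rP] := prec_large_values s (ev t (dom s)).
exists r => // u [ru us]; rewrite /ell -size_cat; congr size.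
apply/tau_uniq/(descent_cat us st (lexx _)).
- move=> x /[dup] xus /andP[_ xs]; rewrite (prec_eq_ev st xs); exact: (rP u).
- exact: descent_tau.
- exact: descent_tau.
Qed.

Local Open Scope ring_scope.

Definition sign := {i : int | (i == 1) || (i == -1)}.
HB.instance Definition _ := Choice.on sign.

Definition pos_sign : sign := Sub 1 isT.
HB.instance Definition _ := isPointed.Build sign pos_sign.

Definition duplicate : Type := (Lambda * sign)%type.
HB.instance Definition _ := Choice.on duplicate.

Definition W (r : option Lambda) (t : Lambda) (i : sign) : set duplicate :=
  [set p | interval r t p.1 /\ val p.2 = (-1) ^+ ell p.1 t * val i].

Definition W_index : set (option Lambda * Lambda * sign) :=
  [set k | prec k.1.1 k.1.2].

Definition W_family (k : option Lambda * Lambda * sign) : set duplicate :=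
  W k.1.1 k.1.2 k.2.

Lemma W_center r t i : prec r t -> W r t i (t, i).
Proof. by move=> rt; split; [split|rewrite ell_refl expr0 mul1r]. Qed.

Lemma W_cover : \bigcup_(k in W_index) W_family k = setT.
Proof.
apply/seteqP; split=> // -[t i] _.
by exists (None, t, i) => //; apply: W_center.
Qed.

Lemma W_shrink r t i p : W r t i p -> exists2 r', prec r' p.1 &
  forall r'', prec r'' p.1 ->
   (forall u, prec_eq u p.1 -> prec r'' u -> prec r' u) -> W r'' p.1 p.2 `<=` W r t i.
Proof.
case: p => s j [[/= rs st] jE]; have [r1 r1s r1P] := ell_add st.
have [r' r's r'P] := prec_max rs r1s.
exists r' => // r'' r''s r''P [u k] [[/= r''u us] kE].
have [ru r1u] := r'P u us (r''P u us r''u).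
split=> /=; first by split=> //; apply: prec_eq_trans st.
by rewrite kE jE mulrA -exprD -r1P.
Qed.

Lemma W_join k1 k2 p : W_index k1 -> W_index k2 ->
  W_family k1 p -> W_family k2 p -> exists k,
  [/\ W_index k, W_family k p & W_family k `<=` W_family k1 `&` W_family k2].
Proof.
move=> _ _ /W_shrink[r1 r1p r1P] /W_shrink[r2 r2p r2P].
have [r rp rP] := prec_max r1p r2p; exists (r, p.1, p.2); split=> //.
  by rewrite /W_family /=; case: p {r1p r2p r1P r2P rP} rp => t i rt; apply: W_center.
move=> q qW; split; [apply: (r1P r)|apply: (r2P r)] => // u up ru.
  by case: (rP u up ru).
by case: (rP u up ru).
Qed.

HB.instance Definition _ := isBaseTopological.Build duplicate W_cover W_join.

Lemma open_W r t i : prec r t -> open (W r t i).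
Proof.
move=> rt; exists [set (r, t, i)]; first by move=> _ ->.
by rewrite bigcup_set1.
Qed.

Lemma open_duplicateP (U : set duplicate) :
  open U <-> forall p, U p -> exists r t i, [/\ prec r t, W r t i p & W r t i `<=` U].
Proof.
split=> [[D' D'W <-] p [[[r t] i] kD kp]|oU].
  exists r, t, i; split=> //; first exact: (D'W _ kD).
  by move=> q qW; exists (r, t, i).
exists [set k | W_index k /\ W_family k `<=` U]; first by move=> k [].
apply/seteqP; split=> p; first by move=> [k [_ kU] /kU].
by move=> /oU[r [t [i [rt pW WU]]]]; exists (r, t, i).
Qed.

Lemma duplicate_hausdorff : hausdorff_space duplicate.
Proof.
rewrite open_hausdorff => -[s i] [t j] /eqP st_neq.
suff [r1 [r2 [p1 p2 W12]]] : exists r1 r2,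
    [/\ prec r1 s, prec r2 t & W r1 s i `&` W r2 t j = set0].
  exists (W r1 s i, W r2 t j) => /=; first by rewrite !inE; split; apply: W_center.
  by split; [exact: open_W|exact: open_W|rewrite W12 eqxx].
have [E|/eqP nst] := eqVneq s t.
  subst t; exists None, None; split=> //; apply/seteqP; split=> // -[u k] [[_ /= kE] [_ /=]]; rewrite kE.
  move=> /(mulfI (negbT (signr_eq0 _ _))) /val_inj ij.
  by apply: st_neq; rewrite ij.
suff [r1 [r2 [p1 p2 d12]]] : exists r1 r2,
    [/\ prec r1 s, prec r2 t & forall u, interval r1 s u -> interval r2 t u -> False].
  exists r1, r2; split=> //; apply/seteqP; split=> // -[u k] [[us _] [ut _]].
  exact: d12 us ut.
have chain s' t' u : interval None s' u -> interval (Some s') t' u -> False.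
  move=> [_ us'] [/prec_dom + _].
  by rewrite ltNge prec_eq_dom.
have [st|st] := pselect (prec_eq s t).
  by exists None, (Some s); split=> //; apply: chain.
have [ts|ts] := pselect (prec_eq t s).
  exists (Some t), None; split=> //; first by split=> // E; apply: nst.
  by move=> u us ut; apply: chain ut us.
have [|d dst dmin] := @omega1_min [set x | fn s x <> fn t x].
  apply: contrapT => nE; apply: nst; apply/Lambda_eqP/funext => x.
  by apply: contrapT => xst; apply: nE; exists x.
have agree x : (x < d)%O -> fn s x = fn t x.
  by move=> xd; apply: contrapT => /dmin; rewrite leNgt xd.
have ds : (d < dom s)%O.
  rewrite ltNge; apply/negP => sd; apply: st => x n xn.
  rewrite -agree //; apply: lt_le_trans sd; by rewrite -fn_dom xn.
have dt : (d < dom t)%O.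
  rewrite ltNge; apply/negP => td; apply: ts => x n xn.
  rewrite agree //; apply: lt_le_trans td; by rewrite -fn_dom xn.
exists (Some (restr s d)), (Some (restr t d)); split; try exact: restr_prec.
move=> u [/prec_dom + us] [_ ut]; rewrite restr_dom ?(ltW ds) // => du.
by apply: dst; rewrite (us _ _ (fn_ev du)) (ut _ _ (fn_ev du)).
Qed.

Definition has_Gdelta_diagonal (X : topologicalType) : Prop :=
  Gdelta (diagonal : set (X * X)).

(* The sequences are indexed from 0 here. *)
Definition Gruenhage (X : topologicalType) : Prop :=
  exists (U : nat -> set (set X)) (R : nat -> set X),
    [/\ forall n V, U n V -> open V,
        forall x y : X, x <> y ->
          exists n V, U n V /\ exists z, [set x; y] `&` V = [set z]
      & forall n V V', U n V -> U n V' -> V <> V' -> V `&` V' = R n].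

(* Main.v *)
Require Import Defs.
From mathcomp Require Import all_boot all_order all_algebra.
From mathcomp Require Import boolp classical_sets topology.
From mathcomp Require Import functions cardinality.

Set Implicit Arguments.
Unset Strict Implicit.
Unset Printing Implicit Defensive.

Import Order.TTheory GRing.Theory.

Local Open Scope classical_set_scope.

(** G-delta diagonal.  Every [t] has a final segment [(r, t]] such that [t] takes
    only values [>= n] from [dom u] on, for all [u] in it ([prec_large_values]).
    Let the [n]-th open cover consist of the basic sets over these segments.
    If [s] strictly precedes [s'], then both cannot lie in one set of the cover
    of index [s' (dom s) + 1], because an extension of [s'] still takes the
    value [s' (dom s)] at [dom s].  Points over the same [t] are separated
    by any basic set, since such a set contains only one of them.

    Not Gruenhage.  The points to look at are the pairs [(t, 1)], [(t, -1)].
    Separating all of them by the given families yields, for every [t], a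
    sign [i t], an open set [G t] that contains [(t, i t)] but not
    [(t, - i t)], and a colour [c t] out of countably many, such that for [s]
    and [t] of the same colour [(s, i s)] belongs to [G t] only if [G s = G t]
    ([Gruenhage_coloring]).  As [G t] is open, it contains some basic set
    [W (r t) t (i t)] with [r t] strictly below [t].

    The tree is so rich that on some somewhere dense set [c] is constant and
    [r] is bounded.  Consider conditions [(t, F)], where the finite set [F] of
    natural numbers is promised never to be taken as a value by the extensions
    of [t].  Sequences of increasingly strong conditions have limits in the
    tree, and a Baire category argument that absorbs the regressive function
    [r] gives a condition [p] and a set [B] of elements of one colour, with
    [r] below the stem of [p] on [B], such that every condition stronger than
    [p] admits an element of [B] ([pressing_down]).

    The length [ell s t] is the number of successive strict minima that [t]
    attains when read from [dom s] on.  Promising to avoid all small values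
    freezes this number, so one finds [w], [s], [t] in [B], each extending
    the previous one, with [ell w s = ell w t = 2] ([refine_even]) and
    [ell s t = 1] ([refine_odd]).  Evenness puts [(w, i w)] into [G s] and
    [G t], hence [G s = G w = G t].  Oddness puts [(s, - i s)] into [G t],
    that is into [G s], a contradiction. *)

(** * Countable suprema and successors of countable ordinals *)

(** Otherwise [omega1] would be a countable union of countable initial
    segments. *)
Lemma omega1_countable_bounded (f : nat -> omega1) : exists d, forall m, (f m <= d)%O.
Proof.
apply: contrapT => nd; apply: omega1_uncountable.
have -> : [set: omega1] = \bigcup_m [set x | (x < f m)%O].
  apply/seteqP; split=> // x _; apply: contrapT => nx; apply: nd.
  exists x => m; rewrite leNgt; apply/negP => xm; by apply: nx; exists m.
by apply: bigcup_countable => // m _; apply: omega1_initial_countable.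
Qed.

Lemma omega1_succ (d : omega1) : exists2 e, (d < e)%O & forall x, (x < e)%O = (x <= d)%O.
Proof.
have [|e de emin] := @omega1_min [set x | (d < x)%O].
  apply: contrapT => nx; apply: omega1_uncountable.
  pose A (b : bool) := if b then [set x | (x < d)%O] else [set d].
  have -> : [set: omega1] = \bigcup_b A b.
    apply/seteqP; split=> // x _; have [xd|dx|->] := ltgtP x d; last by exists false.
    - by exists true.
    - by case: nx; exists x.
  apply: bigcup_countable => // -[] _; first exact: omega1_initial_countable.
  exact: countable1.
exists e => // x; apply/idP/idP => [xe|/le_lt_trans]; last exact.
by rewrite leNgt; apply/negP => /emin; rewrite leNgt xe.
Qed.

(** * Extending elements of the tree *)

Definition ran (t : Lambda) : set nat := [set n | exists x, fn t x = Some n].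

Lemma ran_prec_eq s t : prec_eq s t -> ran s `<=` ran t.
Proof. by move=> st n [x xn]; exists x; apply: st. Qed.

Lemma ran_ev t x : (x < dom t)%O -> ran t (ev t x).
Proof. by move=> /fn_ev xt; exists x. Qed.

Lemma ran_fresh t (F : set nat) m : finite_set F ->
  exists k, [/\ (m <= k)%N, ~ F k & ~ ran t k].
Proof.
move=> finF.
have fin : finite_set (F `|` `I_m) by rewrite finite_setU; split => //; exact: finite_II.
have /infinite_setN0[k [kt kFm]] := infinite_setD (@fn_coinf t) fin.
exists k; split=> //; last by move=> kF; apply: kFm; left.
by rewrite leqNgt; apply/negP => km; apply: kFm; right.
Qed.

(** The successor of [t] with the new value [k]; its domain is the ordinal
    successor of [dom t]. *)
Lemma snoc_exists t k : ~ ran t k -> exists u,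
  [/\ prec (Some t) u, fn u (dom t) = Some k, ran u `<=` ran t `|` [set k]
    & forall x, (x < dom u)%O = (x <= dom t)%O].
Proof.
move=> kt; have [e te eP] := omega1_succ (dom t).
pose f x := if x == dom t then Some k else fn t x.
have fdom x : (f x != None) = (x < e)%O.
  by rewrite eP le_eqVlt /f; have [->|_] := eqVneq x (dom t); rewrite ?fn_dom.
have finj x y n : f x = Some n -> f y = Some n -> x = y.
  rewrite /f; case: eqP => [->|_]; case: eqP => [->|_] //.
  - by move=> [<-] yn; case: kt; exists y.
  - by move=> + [kn]; rewrite -kn => xn; case: kt; exists x.
  - exact: fn_inj.
have fran : [set n | exists x, f x = Some n] `<=` ran t `|` [set k].
  move=> n [x]; rewrite /f; case: eqP => [_ [<-]|_ xn]; first by right.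
  by left; exists x.
have fco : infinite_set (~` [set n | exists x, f x = Some n]).
  apply: (@sub_infinite_set _ (~` ran t `\` [set k])).
    by move=> n [nt nk] /fran[].
  exact: infinite_setD (@fn_coinf t) (finite_set1 k).
exists (MkLambda fdom finj fco); split=> //=; last by rewrite /f eqxx.
split; last by move=> E; move: te; rewrite {1}E /= ltxx.
move=> x n xn /=; rewrite /f; case: eqP => // E; subst x.
by have := fn_dom t (dom t); rewrite xn ltxx.
Qed.

(** The union of an increasing sequence need not have a coinfinite range, as the
    terms may use up all natural numbers; an infinite set [F] avoided by all
    terms excludes this. *)
Lemma chain_union (s : nat -> Lambda) (F : set nat) :
  (forall m, prec_eq (s m) (s m.+1)) -> infinite_set F ->
  (forall m, F `<=` ~` ran (s m)) ->
  exists b, [/\ forall m, prec_eq (s m) b,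
    forall x, (x < dom b)%O -> exists m, (x < dom (s m))%O
    & forall n, ran b n -> exists m, ran (s m) n].
Proof.
move=> sS infF FP.
have sle m m' : (m <= m')%N -> prec_eq (s m) (s m').
  elim: m' => [|m' IH]; first by rewrite leqn0 => /eqP ->; exact: prec_eq_refl.
  rewrite leq_eqVlt ltnS => /orP[/eqP ->|/IH mm']; first exact: prec_eq_refl.
  exact: prec_eq_trans (sS m').
have [|d dub dmin] := @omega1_min [set d | forall m, (dom (s m) <= d)%O].
  by have [d dP] := omega1_countable_bounded (dom \o s); exists d.
pose P x o := if o is Some n then exists m, fn (s m) x = Some n
              else forall m, fn (s m) x = None.
have /choice[f fP] x : exists o, P x o.
  have [[m]|nm] := pselect (exists m, fn (s m) x <> None).
    by case E : (fn (s m) x) => [n|] // _; exists (Some n), m.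
  by exists None => m; apply: contrapT => E; apply: nm; exists m.
have fs m x n : fn (s m) x = Some n -> f x = Some n.
  move=> xn; have := fP x; case: (f x) => [n' [m' xn']|/(_ m)]; last by rewrite xn.
  have [mm'|/ltnW m'm] := leqP m m'.
    by have := sle _ _ mm' _ _ xn; rewrite xn' => -[->].
  by have := sle _ _ m'm _ _ xn'; rewrite xn => -[->].
have sf x n : f x = Some n -> exists m, fn (s m) x = Some n.
  by have := fP x; case: (f x) => // n' + [<-].
have below x : (x < d)%O -> exists m, (x < dom (s m))%O.
  move=> xd; apply: contrapT => nm; move: xd; rewrite ltNge => /negP; apply.
  by apply: dmin => m; rewrite leNgt; apply/negP => xm; apply: nm; exists m.
have fdom x : (f x != None) = (x < d)%O.
  apply/idP/idP.
    case E : (f x) => [n|] // _; have [m xn] := sf _ _ E.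
    by apply: lt_le_trans (dub m); rewrite -fn_dom xn.
  by move=> /below[m /fn_ev/fs ->].
have finj x y n : f x = Some n -> f y = Some n -> x = y.
  move=> /sf[m xn] /sf[m' yn]; apply: (@fn_inj (s (maxn m m')) _ _ n).
    exact: sle (leq_maxl _ _) _ _ xn.
  exact: sle (leq_maxr _ _) _ _ yn.
have fco : infinite_set (~` [set n | exists x, f x = Some n]).
  apply: (sub_infinite_set _ infF) => n Fn [x /sf[m xn]].
  by apply: (FP m n Fn); exists x.
exists (MkLambda fdom finj fco); split=> //=.
by move=> n [x /sf[m xn]]; exists m, x.
Qed.

(** * Conditions and a category argument on the tree *)

(** Conditions are needed because the tree alone has increasing sequences
    without an upper bound: the promises, growing along a sequence, reserve the
    infinite set that its union must avoid. *)
Record condition := Condition {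
  stem : Lambda;
  promise : set nat;
  promise_finite : finite_set promise;
  promise_avoid : forall k, promise k -> ~ ran stem k }.

Definition admits (p : condition) (b : Lambda) : Prop :=
  prec_eq (stem p) b /\ forall k, promise p k -> ~ ran b k.

Definition refines (q p : condition) : Prop :=
  admits p (stem q) /\ promise p `<=` promise q.

Lemma refines_refl p : refines p p.
Proof. by split=> //; split=> //; apply: promise_avoid. Qed.

Lemma refines_admits p q b : refines q p -> admits q b -> admits p b.
Proof.
move=> [[pq _] qp] [qb bq]; split; first exact: prec_eq_trans qb.
by move=> k /qp/bq.
Qed.

Lemma refines_trans p q r : refines q p -> refines r q -> refines r p.
Proof.
move=> pq [qr rq]; split; first exact: refines_admits pq qr.
exact: subset_trans pq.2 rq.
Qed.

(** The tool for controlling [ell]: continue [b] by [k] and promise to avoid all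
    numbers below [k] that [b] has not taken.  Those taken by [b] cannot recur by
    injectivity, so that [k] remains the minimum forever. *)
Lemma refine_snoc p b k : admits p b -> ~ promise p k -> ~ ran b k ->
  exists q, refines q p /\ forall t, admits q t ->
    [/\ prec (Some b) t, ev t (dom b) = k
      & forall x, (dom b <= x < dom t)%O -> (k <= ev t x)%N].
Proof.
move=> [pb bp] kp kb.
have [u [bu uk ub ud]] := snoc_exists kb.
(* The stem of the new condition is [b] continued by [k]. *)
have avoid j : (promise p `|` (`I_k `\` ran b)) j -> ~ ran u j.
  move=> jP /ub[jb|E].
    by case: jP => [/bp//|[]].
  by move: jP; rewrite E => -[//|[]]; rewrite /= ltnn.
have fin : finite_set (promise p `|` (`I_k `\` ran b)).
  rewrite finite_setU; split; first exact: promise_finite.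
  exact/finite_setD/finite_II.
exists (Condition fin avoid); split.
  split=> /=; last by move=> j; left.
  split; first exact: prec_eq_trans bu.1.
  by move=> j jp; apply: avoid; left.
move=> t [/= ut tP]; have bt := prec_prec_eq bu ut; split=> //.
  by rewrite /ev (ut _ _ uk).
move=> x /andP[bx xt]; rewrite leqNgt; apply/negP => xk.
apply: (tP (ev t x)); last exact: ran_ev.
right; split=> // -[y /[dup] yb /bt.1 yt].
have yx : y = x by apply: (fn_inj yt); exact: fn_ev.
have : (y < dom b)%O by rewrite -fn_dom yb.
by rewrite ltNge yx bx.
Qed.

(** The promise receives a new element [k >= m], so that the promises along a
    sequence of such steps have an infinite union. *)
Lemma refine_strictly p m : exists q,
  [/\ refines q p, prec (Some (stem p)) (stem q)
    & exists2 k, (m <= k)%N & promise q k].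
Proof.
have [k [_ kp ks]] := ran_fresh (stem p) 0 (promise_finite p).
have [u [su _ us _]] := snoc_exists ks.
have [j [mj jp ju]] := ran_fresh u m (promise_finite p).
have up i : promise p i -> ~ ran u i.
  by move=> ip /us[/(promise_avoid ip)//|E]; apply: kp; rewrite -E.
have avoid i : (promise p `|` [set j]) i -> ~ ran u i by move=> [/up//|->].
have fin : finite_set (promise p `|` [set j]).
  by rewrite finite_setU; split; [exact: promise_finite|exact: finite_set1].
exists (Condition fin avoid); split=> //=; last by exists j => //; right.
by split=> /=; [split=> //; exact: su.1|move=> i; left].
Qed.

Lemma unbounded_infinite (F : set nat) :
  (forall m, exists2 k, (m <= k)%N & F k) -> infinite_set F.
Proof.
move=> Funb /finite_seqP[s Fs]; have [k + Fk] := Funb (\max_(i <- s) i).+1.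
by rewrite ltnNge => /negP; apply; apply: leq_bigmax_seq => //; rewrite Fs in Fk.
Qed.

(** A Baire category theorem and a pressing-down lemma at once.  If it fails,
    then one can build a sequence of conditions whose [m]-th step avoids all [b]
    of the colour assigned to [m] with [r b] below the [m]-th stem.  Let [b] be the
    limit.  Being strictly below the limit, [r b] is below some stem, hence below
    all later ones; as each colour is assigned to arbitrarily large [m], one
    of the steps has excluded [b]. *)
Lemma pressing_down (c : Lambda -> nat) (r : Lambda -> option Lambda) :
  (forall t, prec (r t) t) -> exists n p, forall q, refines q p ->
    exists b, [/\ admits q b, c b = n & prec (r b) (stem p)].
Proof.
move=> rt; apply: contrapT => nex.
(* The colour assigned to [m] is [logn 2 m.+1], which takes each value infinitely
   often. *)
have step (mp : nat * condition) : exists q,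
    [/\ refines q mp.2, prec (Some (stem mp.2)) (stem q),
      exists2 k, (mp.1 <= k)%N & promise q k
    & forall b, admits q b -> c b = logn 2 mp.1.+1 -> ~ prec (r b) (stem mp.2)].
  case: mp => m p /=; apply: contrapT => nq; apply: nex.
  exists (logn 2 m.+1), p => q qp; apply: contrapT => nb; apply: nq.
  have [q' [q'q sq' q'm]] := refine_strictly q m.
  exists q'; split=> //.
  - exact: refines_trans q'q.
  - exact: prec_eq_prec qp.1.1 sq'.
  - move=> b q'b cb rb; apply: nb; exists b; split=> //.
    exact: refines_admits q'b.
have [g gP] := choice step.
have avoid0 k : set0 k -> ~ ran empty_fun k by [].
pose P := nat_rect (fun=> condition) (Condition (finite_set0 nat) avoid0)
  (fun m p => g (m, p)).
have Pref m : refines (P m.+1) (P m) by case: (gP (m, P m)).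
have Pstem m : prec (Some (stem (P m))) (stem (P m.+1)) by case: (gP (m, P m)).
have Ple m m' : (m <= m')%N -> refines (P m') (P m).
  elim: m' => [|m' IH]; first by rewrite leqn0 => /eqP ->; exact: refines_refl.
  rewrite leq_eqVlt ltnS => /orP[/eqP ->|/IH mm']; first exact: refines_refl.
  exact: refines_trans (Pref m').
have Pavoid m m' k : promise (P m) k -> ~ ran (stem (P m')) k.
  move=> km kr; have [mm'|/ltnW m'm] := leqP m m'.
    exact: ((Ple _ _ mm').1.2 k).
  by apply: (promise_avoid km); apply: ran_prec_eq kr; exact: (Ple _ _ m'm).1.1.
have [||m k [m' _ km']|b [Pb bdom bran]] := @chain_union (stem \o P) (\bigcup_m promise (P m)).
- by move=> m; exact: (Pstem m).1.
- apply: unbounded_infinite => m; have [_ _ [k mk kP] _] := gP (m, P m).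
  by exists k => //; exists m.+1.
- exact: Pavoid km'.
have Pbp m : admits (P m) b.
  by split; [exact: Pb|move=> k km /bran[m' ]; exact: Pavoid km].
have [m rbm] : exists m, prec (r b) (stem (P m)).
  have := rt b; case: (r b) => [u ub|]; last by exists 0%N.
  have [m um] := bdom _ (prec_dom ub).
  exists m; split; first by apply: (prec_eq_under ub.1 (Pb m)); exact: ltW.
  by move=> E; move: um; rewrite E ltxx.
(* The odd factor makes [m'] at least [m] without changing the colour. *)
pose m' := (2 ^ c b * m.*2.+1).-1.
have m'S : m'.+1 = (2 ^ c b * m.*2.+1)%N by rewrite prednK // muln_gt0 expn_gt0.
have m'c : logn 2 m'.+1 = c b.
  by rewrite m'S lognM ?expn_gt0 // pfactorK // lognE dvdn2 /= odd_double /= addn0.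
have mm' : (m <= m')%N.
  rewrite -ltnS m'S; apply: (@leq_trans m.*2.+1); first by rewrite ltnS -addnn leq_addr.
  by rewrite leq_pmull // expn_gt0.
have [_ _ _ /(_ b (Pbp m'.+1))] := gP (m', P m'); apply; first by rewrite m'c.
exact: prec_prec_eq rbm (Ple _ _ mm').1.1.
Qed.

(** * Counting records *)

Lemma ell_one u t : (dom u < dom t)%O -> prec_eq u t ->
  (forall x, (dom u <= x < dom t)%O -> (ev t (dom u) <= ev t x)%N) -> ell u t = 1%N.
Proof.
move=> ut put umin; rewrite /ell (@tau_uniq _ _ (rcons [::] (dom u))) //.
by apply: DescentStep => //; [split; rewrite ?lexx|exact: DescentStop].
Qed.

(** The minima are [c] on the whole interval and [dom u] before [c]; nothing else
    lies before [c], which is the ordinal successor of [dom u]. *)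
Lemma ell_two u t c : prec_eq u t -> (dom u < c < dom t)%O ->
  (forall x, (x < c)%O -> (x <= dom u)%O) ->
  (forall x, (dom u <= x < dom t)%O -> (ev t c <= ev t x)%N) -> ell u t = 2%N.
Proof.
move=> put /andP[uc ct] cS cmin.
rewrite /ell (@tau_uniq _ _ (rcons (rcons [::] (dom u)) c)) //.
apply: DescentStep; first exact: lt_trans ct.
  by split=> //; rewrite (ltW uc).
apply: DescentStep => //; last exact: DescentStop.
split; first by rewrite lexx.
move=> x /andP[ux /cS xu]; have -> // : x = dom u.
by apply: le_anti; rewrite xu ux.
Qed.

(** Frozen, the first value after [s] is the only minimum. *)
Lemma refine_odd p s : admits p s -> exists q, refines q p /\
  forall t, admits q t -> prec (Some s) t /\ ell s t = 1%N.
Proof.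
move=> ps; have [k [_ kp ks]] := ran_fresh s 0 (promise_finite p).
have [q [qp qP]] := refine_snoc ps kp ks.
exists q; split=> // t /qP[st sk smin]; split=> //.
by apply: ell_one => [||x]; [exact: prec_dom|exact: st.1|rewrite sk; exact: smin].
Qed.

(** Continue [w] by [j] and then by [k < j], with [k] the minimum forever.  The
    number is even but not zero, so that it leaves room for a further step between
    [w] and [t] that [refine_odd] sees and [w] does not. *)
Lemma refine_even p w : admits p w -> exists q, refines q p /\
  forall t, admits q t -> prec (Some w) t /\ ell w t = 2%N.
Proof.
move=> pw; have [k [_ kp kw]] := ran_fresh w 0 (promise_finite p).
have [j [kj jp jw]] := ran_fresh w k.+1 (promise_finite p).
have [u [wu uj ru ud]] := snoc_exists jw.
(* Only [k] is frozen: freezing [j] would promise to avoid [k]. *)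
have pu : admits p u.
  split; first exact: prec_eq_trans pw.1 wu.1.
  by move=> i ip /ru[/(pw.2 _ ip)//|E]; apply: jp; rewrite -E.
have ku : ~ ran u k by move=> /ru[//|E]; rewrite E ltnn in kj.
have [q [qp qP]] := refine_snoc pu kp ku.
exists q; split=> // t /qP[ut uk umin].
have wt := prec_eq_prec wu.1 ut; split=> //.
apply: (ell_two (c := dom u)); first exact: wt.1.
- by rewrite !prec_dom.
- by move=> x; rewrite ud.
- move=> x /andP[wx xt]; rewrite uk; have [ux|] := leP (dom u) x.
    by apply: umin; rewrite ux.
  rewrite ud => xw; have -> : x = dom w by apply: le_anti; rewrite xw wx.
  by rewrite /ev (ut.1 _ _ uj) /= ltnW.
Qed.

(** * The duplicate *)

Local Open Scope ring_scope.

Lemma W_nbhs (U : set duplicate) t i : open U -> U (t, i) ->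
  exists2 r, prec r t & W r t i `<=` U.
Proof.
move=> /open_duplicateP oU /oU[r [t' [i' [_ /W_shrink[r' r't r'P] WU]]]].
exists r' => //; exact: subset_trans (r'P r' r't (fun _ _ h => h)) WU.
Qed.

Lemma duplicate_Gdelta_diagonal : has_Gdelta_diagonal duplicate.
Proof.
have far (nt : nat * Lambda) : exists r, prec r nt.2 /\
    forall u, prec_eq u nt.2 -> prec r u ->
    forall x, (dom u <= x < dom nt.2)%O -> (nt.1 <= ev nt.2 x)%N.
  by have [r rt rP] := prec_large_values nt.2 nt.1; exists r.
have [r rP] := choice far.
pose N n (k : Lambda * sign) := W (r (n, k.1)) k.1 k.2.
exists (fun n => \bigcup_(k in setT) (N n k `*` N n k)).
  move=> n; apply: bigcup_open => -[t i] _.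
  have oN : open (N n (t, i)) by apply: open_W; case: (rP (n, t)).
  rewrite openE => -[x y] [/= xN yN]; exists (N n (t, i), N n (t, i)) => //=.
  by split; apply: open_nbhs_nbhs.
apply/seteqP; split=> [[x y] /= xy n _|[x y] xyN].
  rewrite /diagonal /= in xy; subst y; case: x => t i; exists (t, i) => //.
  by split; apply: W_center; case: (rP (n, t)).
have common n : exists t i, N n (t, i) x /\ N n (t, i) y.
  by have [[t i] _ [/= xN yN]] := xyN n I; exists t, i.
(* A strict extension takes a value at [dom s]; it is too small for large [n]. *)
have no_ext s s' : prec (Some s) s' -> ~ forall n, exists t,
    Defs.interval (r (n, t)) t s /\ prec_eq s' t.
  move=> ss' /(_ (ev s' (dom s)).+1)[t [[rs st] s't]].
  have sd := prec_dom ss'; have [_ /(_ s st rs (dom s))] := rP ((ev s' (dom s)).+1, t).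
  rewrite /= lexx (lt_le_trans sd (prec_eq_dom s't)) (prec_eq_ev s't sd) ltnn.
  by move=> /(_ isT).
case: x y common {xyN} => s i [s' i'] common; rewrite /diagonal /=.
have ss' : s = s'.
  apply: contrapT => nss'; have [t [j [[[_ /= st] _] [[_ /= s't] _]]]] := common 0%N.
  case/orP: (le_total (dom s) (dom s')) => [le|le].
    apply: (@no_ext s s') => [|n]; first by split=> //; exact: prec_eq_under st s't le.
    by have [t' [j' [[/= It _] [[_ /= st'] _]]]] := common n; exists t'.
  apply: (@no_ext s' s) => [|n]; first by split=> [|/esym//]; exact: prec_eq_under s't st le.
  by have [t' [j' [[[_ /= st'] _] [/= It _]]]] := common n; exists t'.
subst s'; have [t [j [[_ /= iE] [_ /= i'E]]]] := common 0%N.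
by congr (_, _); apply: val_inj; exact: etrans iE (esym i'E).
Qed.

Lemma opposite_sign_proof (i : sign) : (- val i == 1) || (- val i == -1).
Proof. by case/orP: (valP i) => /eqP ->; rewrite ?opprK eqxx ?orbT. Qed.

Definition opposite (i : sign) : sign := Sub (- val i) (opposite_sign_proof i).

Lemma W_even r s t i : Defs.interval r t s -> ~~ odd (ell s t) -> W r t i (s, i).
Proof. by move=> rst /negbTE ev; split=> //=; rewrite -signr_odd ev mul1r. Qed.

Lemma W_odd r s t i : Defs.interval r t s -> odd (ell s t) -> W r t i (s, opposite i).
Proof. by move=> rst od; split=> //=; rewrite -signr_odd od mulN1r. Qed.

Lemma sign_bool (i : sign) : i = if val i == 1 then pos_sign else opposite pos_sign.
Proof. by apply: val_inj; case/orP: (valP i) => /eqP E; rewrite E. Qed.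

(** Let [V t] be the member of the family [U (n t)] that separates the two points
    over [t], and [i t] the sign of the one inside.  The colour records [n t],
    [i t] and whether [(t, i t)] is an interior point of [R (n t)].  If it is not,
    then [V t] serves as [G t]: a common point [(s, i s)] of distinct [V s] and
    [V t] belongs to their open intersection [R (n t)], hence is interior.
    If it is, then [V t] is replaced by its intersection with the interior
    of [R (n t)]: distinct [V s] and [V t] both contain [R (n t)], so that the
    intersections coincide. *)
Lemma Gruenhage_coloring : Gruenhage duplicate ->
  exists (c : Lambda -> nat) (i : Lambda -> sign) (G : Lambda -> set duplicate),
    [/\ forall t, open (G t), forall t, G t (t, i t), forall t, ~ G t (t, opposite (i t))
      & forall s t, c s = c t -> i s = i t /\ (G t (s, i s) -> G s = G t)].
Proof.
move=> [U [R [Uo Usep UR]]].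
have sep t : exists niV : nat * sign * set duplicate,
    [/\ U niV.1.1 niV.2, niV.2 (t, niV.1.2) & ~ niV.2 (t, opposite niV.1.2)].
  have pN : pos_sign <> opposite pos_sign by move=> /(congr1 val).
  have oK : opposite (opposite pos_sign) = pos_sign by apply: val_inj.
  have [|n [V [UV [z E]]]] := Usep (t, pos_sign) (t, opposite pos_sign).
    by move=> /(congr1 snd)/pN.
  have [zE Vz] : ([set (t, pos_sign); (t, opposite pos_sign)] `&` V) z by rewrite E.
  have other w : [set (t, pos_sign); (t, opposite pos_sign)] w -> V w -> w = z.
    by move=> wE Vw; have : [set z] w by rewrite -E.
  case: zE => zE; rewrite {}zE in Vz other.
    exists (n, pos_sign, V); split=> //= /(other _ (or_intror erefl)).
    by move=> /(congr1 snd)/esym/pN.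
  exists (n, opposite pos_sign, V); split=> //=; rewrite oK.
  by move=> /(other _ (or_introl erefl)) /(congr1 snd)/pN.
have [f fP] := choice sep.
pose n t := (f t).1.1; pose i t := (f t).1.2; pose V t := (f t).2.
have UV t : U (n t) (V t) by case: (fP t).
pose core t := (R (n t))^° (t, i t).
pose G t := if `[< core t >] then V t `&` (R (n t))^° else V t.
exists (fun t => pickle (n t, val (i t) == 1, `[< core t >])), i, G; split.
- move=> t; rewrite /G; case: asboolP => _; last exact: Uo (UV t).
  by apply: openI; [exact: Uo (UV t)|exact: open_interior].
- by move=> t; rewrite /G; case: (fP t) => _ Vt _; case: asboolP.
- by move=> t; rewrite /G; case: (fP t) => _ _ nVt; case: asboolP => // _ [/nVt].
move=> s t /(pcan_inj pickleK)[nE iE cE].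
have stE : i s = i t by rewrite (sign_bool (i s)) iE -sign_bool.
split=> //; have [E|nE'] := pselect (V s = V t).
  by rewrite /G cE nE E.
have VR : V s `&` V t = R (n t) by apply: (UR (n t)) => //; rewrite -?nE; exact: UV.
rewrite /G cE nE; case: asboolP => [_ _|ncore Vts].
  rewrite -VR; apply/seteqP; split=> z [_ zR]; split=> //.
    by have [] := interior_subset zR.
  by have [] := interior_subset zR.
have ncs : ~ core s by apply/asboolPn; rewrite cE; apply/asboolPn.
case: ncs; rewrite /core nE -VR; have /interior_id -> : open (V s `&` V t).
  by apply: openI; [exact: Uo (UV s)|exact: Uo (UV t)].
by split=> //; case: (fP s).
Qed.

Lemma duplicate_not_Gruenhage : ~ Gruenhage duplicate.
Proof.
move=> /Gruenhage_coloring[c [i [G [Go Gt nGt GP]]]].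
have nb t : exists r, prec r t /\ W r t (i t) `<=` G t.
  by have [r rt rG] := W_nbhs (Go t) (Gt t); exists r.
have [r rP] := choice nb.
have [n [p pP]] := @pressing_down c r (fun t => (rP t).1).
have [w [pw wn rw]] := pP p (refines_refl p).
have [q [qp qP]] := refine_even pw.
have [s [qs sn rs]] := pP q qp.
have [q' [q'q q'P]] := refine_odd qs.
have [t [q't tn rt]] := pP q' (refines_trans qp q'q).
have [ws evs] := qP s qs.
have [wt evt] := qP t (refines_admits q'q q't).
have [st odt] := q'P t q't.
have seg u v : prec_eq (stem p) u -> prec (Some u) v -> prec (r v) (stem p) ->
    Defs.interval (r v) v u.
  by move=> pu uv rv; split; [exact: prec_prec_eq rv pu|exact: uv.1].
have same v : prec (Some w) v -> ell w v = 2%N -> c v = n ->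
    prec (r v) (stem p) -> G w = G v.
  move=> wv ev cv rv; have [ie] := GP w v (etrans wn (esym cv)); apply.
  rewrite ie; apply: (rP v).2; apply: W_even; last by rewrite ev.
  exact: seg pw.1 wv rv.
apply: (nGt s); rewrite -(same s) // (same t) //.
have [-> _] := GP s t (etrans sn (esym tn)).
apply: (rP t).2; apply: W_odd; last by rewrite odt.
exact: seg (refines_admits qp qs).1 st rt.
Qed.

Theorem theorem2p4 :
  has_Gdelta_diagonal duplicate /\ ~ Gruenhage duplicate.
Proof. exact: conj duplicate_Gdelta_diagonal duplicate_not_Gruenhage. Qed.
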